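(* Let $p>3$ be a prime. Let $o=o_p(-2)$ be the multiplicative order of $-2$ in $\mathbb{F}_p^{\times}$, let $r_3\in\{0,1,2\}$ be the residue of $o$ modulo $3$ and let $r_2\in\{0,1\}$ be the residue of $o$ modulo $2$. There is a constant $c_p$ with $1\le c_p\leq 3$, depending only on $p$ and satisfying $\mathrm{sat}((2,-1),\mathbb{Z}_p)<\sqrt{c_p\cdot p}$, such that for every positive integer $k$: (1) $$\sqrt{2/3}\cdot p^{k}<\mathrm{sat}(3\text{-}\mathrm{AP}, \mathbb{F}_p^{2k})\leq \left(\frac43+\frac{2r_3}{3\cdot o}\right)(p^k-1);$$ (2) $$\sqrt{2/3}\cdot p^{k+\frac12}<\mathrm{sat}(3\text{-}\mathrm{AP}, \mathbb{F}_p^{2k+1})\leq \frac23(p^{k+1}+p^k-2)+\frac{r_3(p^{k+1}+p^k-2)}{3\cdot o};$$ (3) $$p^{k}<\mathrm{sat}((2, -1), \mathbb{F}_p^{2k})\leq \left(\frac32+\frac{r_2}{2\cdot o}\right)(p^k-1);$$ (4) $$p^{k+\frac12}<\mathrm{sat}((2, -1), \mathbb{F}_p^{2k+1})\leq \sqrt{c_p}\left(\frac32+\frac{r_2}{2\cdot o}\right)(p^k-1)\sqrt{p}.$$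
   Context: A $3$-AP of an abelian group $G$ is a set of three distinct elements of the form $g,g+d,g+2d$ with $g,d\in G$. A set $S\subseteq G$ is $3$-AP saturating if for each $x\in G\setminus S$ there is a $3$-AP of $G$ consisting of $x$ and two elements of $S$; $\mathrm{sat}(3\text{-}\mathrm{AP},G)$ is the minimum size of such a set. A set $A\subseteq G$ is $(2,-1)$-saturating if for each $x\in G\setminus A$ there are $a',a''\in A$, $a'\ne a''$, with $x=2a'-a''$; $\mathrm{sat}((2,-1),G)$ is the minimum size of such a set. $\mathbb{Z}_p$ is the cyclic group of order $p$ (the additive group of $\mathbb{F}_p$). *)

(* Defs.v *)
From HB Require Import structures.
From mathcomp Require Import all_boot all_order all_algebra all_fingroup.

Set Implicit Arguments.
Unset Strict Implicit.
Unset Printing Implicit Defensive.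

Import GRing.Theory.
Local Open Scope ring_scope.

Section Saturation.
Variable G : finZmodType.
Implicit Types (A B S : {set G}) (P : pred {set G}).

Definition is_3AP B : bool :=
  (#|B| == 3)%N && [exists g : G, exists d : G, B == [set g; g + d; g + d *+ 2]].

Definition AP3_saturating S : bool :=
  [forall x, (x \notin S) ==>
    [exists a in S, exists b in S, is_3AP [set x; a; b]]].

Definition saturating21 A : bool :=
  [forall x, (x \notin A) ==>
    [exists a in A, exists b in A, (a != b) && (x == a *+ 2 - b)]].

(* The default [set: G] of the arg min is itself saturating in both senses
   (lemmas below), so these are genuine minima. *)
Definition sat_3AP : nat :=
  #|[arg min_(S < [set: G] | AP3_saturating S) #|S| ]%N|.

Definition sat_21 : nat :=
  #|[arg min_(A < [set: G] | saturating21 A) #|A| ]%N|.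

Lemma AP3_saturatingT : AP3_saturating [set: G].
Proof. by apply/forallP => x; rewrite inE. Qed.

Lemma saturating21T : saturating21 [set: G].
Proof. by apply/forallP => x; rewrite inE. Qed.

Lemma sat_3AP_min S : AP3_saturating S -> (sat_3AP <= #|S|)%N.
Proof.
by rewrite /sat_3AP; case: arg_minnP => [|A _ minA]; [exact: AP3_saturatingT|exact: minA].
Qed.

Lemma sat_3AP_attained : exists2 S, AP3_saturating S & #|S| = sat_3AP.
Proof.
rewrite /sat_3AP; case: arg_minnP => [|A satA _]; first exact: AP3_saturatingT.
by exists A.
Qed.

Lemma sat_21_min A : saturating21 A -> (sat_21 <= #|A|)%N.
Proof.
by rewrite /sat_21; case: arg_minnP => [|B _ minB]; [exact: saturating21T|exact: minB].
Qed.

Lemma sat_21_attained : exists2 A, saturating21 A & #|A| = sat_21.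
Proof.
rewrite /sat_21; case: arg_minnP => [|A satA _]; first exact: saturating21T.
by exists A.
Qed.

End Saturation.

Arguments sat_3AP G : clear implicits.
Arguments sat_21 G : clear implicits.

Lemma Fp_neg2_unit (p : nat) : prime p -> (3 < p)%N ->
  (- 2%:R : 'F_p) \is a GRing.unit.
Proof.
move=> p_pr p_gt3; rewrite unitfE oppr_eq0 -(dvdn_pcharf (pchar_Fp p_pr)).
by rewrite gtnNdvd // (ltn_trans _ p_gt3).
Qed.

Definition order_neg2 (p : nat) (p_pr : prime p) (p_gt3 : (3 < p)%N) : nat :=
  #[FinRing.unit 'F_p (Fp_neg2_unit p_pr p_gt3)]%g.

(* Main.v *)
Require Import Defs.
From mathcomp Require Import all_boot all_order all_algebra fingroup cyclic.
From mathcomp Require Import reals exp.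
From mathcomp Require Import zify ring lra.
Set Implicit Arguments.
Unset Strict Implicit.
Unset Printing Implicit Defensive.
Import Order.TTheory GRing.Theory Num.Theory.
Local Open Scope ring_scope.

(* Lower bounds come from counting the points 2a - b and (a + b)/2 spanned by
   pairs. Equality #|G| = #|A|^2 in the (2,-1) case would make (a, b) |-> 2a - b
   a bijection from A x A onto G, which a parity argument excludes.

   Upper bounds: on the axes of F_p^a x F_p^b put sets X and Y that are unions of
   arcs of the orbits of v |-> -2v. If every third (resp. second) point of each
   orbit is left out, then at least two of v, -2v, 4v (resp. one of v, -2v)
   remain. With (u, v) = (2x, 2y), the identities
     2(u, v) = (4x, 0) + (0, 4y),
     (u, v) = 2(x, 0) - (0, -2y) = 2(0, y) - (-2x, 0)
   then cover every point off the axes, and v = 2(-v/2) - (-2v) covers those on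
   them. The remainder r3 (resp. r2) is the cost of an orbit length not divisible
   by 3 (resp. 2). In odd dimension, (2,-1)-saturating sets multiply.

   One may take c_p = 3: an interval together with an arithmetic progression
   saturates Z_p with fewer than sqrt(3p) elements. *)

(** * Two general facts: repeated pairs in (2,-1)-saturation, and fixed points of involutions *)

Lemma saturating21P (G : finZmodType) (A : {set G}) :
  reflect (forall x, exists2 ab, ab \in setX A A & x = ab.1 *+ 2 - ab.2) (saturating21 A).
Proof.
apply: (iffP forallP) => satA x; last first.
  apply/implyP => xA; have [[a b] /setXP[aA bA] /= xE] := satA x.
  apply/existsP; exists a; rewrite aA; apply/existsP; exists b; rewrite bA xE eqxx andbT.
  (* Distinctness is automatic: [a = b] gives 2a - b = a, which lies in [A]. Conversely a point of
     [A] is 2x - x, so the spanning condition can be asked of all points. *)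
  by apply: contraNneq xA => ab; rewrite xE ab mulr2n addrK -ab.
have [xA | xA] := boolP (x \in A).
  by exists (x, x); rewrite ?inE ?xA //= mulr2n addrK.
have /implyP/(_ xA)/existsP[a /andP[aA]] := satA x.
by case/existsP=> b /and3P[bA _ /eqP->]; exists (a, b); rewrite ?inE ?aA.
Qed.

(** Removing a two-element orbit {x, f x} from [A] keeps its parity and its stability under [f]. *)
Lemma involution_odd_fixed (T : finType) (f : T -> T) (A : {set T}) :
    involutive f -> {in A, forall x, f x \in A} -> odd #|A| -> exists2 x, x \in A & f x = x.
Proof.
move=> fK; have [n leAn] := ubnP #|A|.
elim: n A leAn => // n IHn A leAn fA oddA.
have /set0Pn[x xA] : A != set0 by apply: contraTneq oddA => ->; rewrite cards0.
have [fx | fx] := eqVneq (f x) x; first by exists x.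
have xfA : [set x; f x] \subset A by rewrite subUset !sub1set xA fA.
have := cardsID [set x; f x] A; rewrite (setIidPr xfA) cards2 eq_sym fx /= => cA.
have [||| y] := IHn (A :\: [set x; f x]).
- by rewrite -cA in leAn; lia.
- move=> y; rewrite !inE !negb_or => /andP[/andP[yx yfx] yA].
  by rewrite (can2_eq fK fK) yfx (inj_eq (can_inj fK)) yx fA.
- by move: oddA; rewrite -cA oddD.
by rewrite inE => /andP[_ yA]; exists y.
Qed.

(** * Lower bounds by counting, in abelian groups of odd order *)

Section OddOrder.
Variable G : finZmodType.
Hypothesis oddG : odd #|G|.

(** Since |G| kills [G], multiplication by (|G| + 1)/2 inverts doubling. *)
Lemma double_inj : injective (fun x : G => x + x).
Proof.
have card0 (x : G) : x *+ #|G| = 0.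
  by rewrite -cardsT -FinRing.zmodXgE; apply: (@expg_cardG _ [set: G]%G); rewrite inE.
pose half (x : G) := x *+ #|G|./2.+1.
apply: (can_inj (g := half)) => x; rewrite /half -mulr2n -mulrnA.
have -> : (2 * #|G|./2.+1 = #|G|.+1)%N by have := odd_double_half #|G|; rewrite oddG; lia.
by rewrite mulrSr card0 add0r.
Qed.

(** The three alternatives say which point is the middle of the progression: [x], [a] or [b]. *)
Lemma three_point_AP (x a b : G) :
    x != a -> x != b -> a != b -> [|| x + x == a + b, x == a *+ 2 - b | x == b *+ 2 - a] ->
  is_3AP [set x; a; b].
Proof.
move=> xa xb ab H; apply/andP; split.
  by rewrite -setUA cardsU1 cards2 !inE negb_or xa xb ab.
have AP (g d : G) S : S = [set g; g + d; g + d *+ 2] ->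
    [exists g : G, exists d : G, S == [set g; g + d; g + d *+ 2]].
  by move=> ->; apply/existsP; exists g; apply/existsP; exists d.
case/or3P: H => /eqP E.
- apply: (AP a (x - a)); have -> : a + (x - a) = x by rewrite addrC subrK.
  have -> : a + (x - a) *+ 2 = b.
    have -> : b = x + x - a by rewrite E addrAC subrr add0r.
    by rewrite mulrnBl !mulr2n opprD addrCA (addrA a) subrr add0r.
  by apply/setP => y; rewrite !inE; do !case: eqP.
- apply: (AP x (a - x)); have -> : x + (a - x) = a by rewrite addrC subrK.
  have -> : x + (a - x) *+ 2 = b.
    have -> : b = a *+ 2 - x by rewrite E opprB addrC subrK.
    by rewrite mulrnBl (mulr2n x) opprD addrCA (addrA x) subrr add0r.
  by [].
- apply: (AP x (b - x)); have -> : x + (b - x) = b by rewrite addrC subrK.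
  have -> : x + (b - x) *+ 2 = a.
    have -> : a = b *+ 2 - x by rewrite E opprB addrC subrK.
    by rewrite mulrnBl (mulr2n x) opprD addrCA (addrA x) subrr add0r.
  by apply/setP => y; rewrite !inE; do !case: eqP.
Qed.

(** Two alternatives suffice: when [x] is an end of the progression, [a] is chosen to be its
    middle. *)
Lemma AP3_saturatingE S : AP3_saturating S ->
  forall x, x \notin S -> exists a b : G, [/\ a \in S, b \in S, a != b &
     (x + x == a + b) || (x == a *+ 2 - b)].
Proof.
move=> /forallP satS x xS; have /implyP/(_ xS)/existsP[a /andP[aS]] := satS x.
case/existsP=> b /andP[bS] /andP[].
have xa : x != a by apply: contraNneq xS => ->.
have xb : x != b by apply: contraNneq xS => ->.
have [-> | ab _] := eqVneq a b.
  by rewrite -setUA setUid cards2 xb.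
case/existsP => g /existsP[d /eqP E].
have E3 y : (y \in [set x; a; b]) = (y \in [set g; g + d; g + d *+ 2]) by rewrite E.
have : x \in [set g; g + d; g + d *+ 2] by rewrite -E3 !inE eqxx.
have : a \in [set g; g + d; g + d *+ 2] by rewrite -E3 !inE eqxx !orbT.
have : b \in [set g; g + d; g + d *+ 2] by rewrite -E3 !inE eqxx !orbT.
have mid : (g + d) + (g + d) = g + (g + d *+ 2) by rewrite mulr2n [RHS]addrA addrACA.
have left : g = (g + d) *+ 2 - (g + d *+ 2).
  by rewrite mulrnDl (mulr2n g) opprD addrACA subrr addr0 addrK.
have right : g + d *+ 2 = (g + d) *+ 2 - g.
  by rewrite mulrnDl [g *+ 2]mulr2n addrAC addrK.
(* Among the 27 assignments of positions to [b], [a], [x], those with a repetition contradict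
   distinctness. *)
rewrite !inE -!orbA => /or3P[]/eqP Eb /or3P[]/eqP Ea /or3P[]/eqP Ex;
  first [ by rewrite Ex Ea eqxx in xa | by rewrite Ex Eb eqxx in xb
        | by rewrite Ea Eb eqxx in ab
        | by exists a, b; split=> //; rewrite Ex Ea Eb mid ?eqxx // addrC eqxx
        | by exists a, b; split=> //; rewrite Ex Ea Eb -?left -?right eqxx orbT
        | by exists b, a; split; rewrite // 1?(eq_sym b) // Ex Ea Eb -?left -?right eqxx orbT].
Qed.

(** With s = |S|, ordered pairs give at most s^2 values 2a - b (the points of [S] among them, as 2a
    - a), and unordered pairs give at most s(s - 1)/2 midpoints, doubling being injective. As s > 0,
    the sum is less than 3s^2/2. *)
Lemma sat_3AP_lower : (2 * #|G| < 3 * sat_3AP G ^ 2)%N.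
Proof.
have [S satS <-] := sat_3AP_attained G; have AP := AP3_saturatingE satS.
have gt0G : (0 < #|G|)%N by rewrite odd_gt0.
pose T := [set x | [exists B in [set B : {set G} | B \subset S & #|B| == 2%N],
                      x + x == \sum_(b in B) b]].
pose U := [set ab.1 *+ 2 - ab.2 | ab in setX S S].
have UT : [set: G] \subset U :|: T.
  apply/subsetP => x _; rewrite inE; have [xS | xS] := boolP (x \in S).
    by apply/orP; left; apply/imsetP; exists (x, x); rewrite ?inE ?xS //= mulr2n addrK.
  have [a [b [aS bS ab]]] := AP x xS; case/orP=> /eqP xE; apply/orP; [right | left].
    rewrite inE; apply/existsP; exists [set a; b].
    by rewrite inE subUset !sub1set aS bS cards2 ab big_setU1 ?inE // big_set1 xE /= eqxx.
  by apply/imsetP; exists (a, b); rewrite ?inE ?aS.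
have cU : (#|U| <= #|S| ^ 2)%N by rewrite expnS expn1 -cardsX leq_imset_card.
have cT : (#|T| <= 'C(#|S|, 2))%N.
  rewrite -cards_draws -(card_imset (mem T) double_inj).
  apply: leq_trans (leq_imset_card (fun B : {set G} => \sum_(b in B) b) _).
  apply/subset_leq_card/subsetP => _ /imsetP[x + ->]; rewrite inE => /existsP[B /andP[BS /eqP->]].
  exact: imset_f.
have cG : (#|G| <= #|U| + #|T|)%N.
  by rewrite -cardsT (leq_trans (subset_leq_card UT)) // cardsU leq_subr.
have : ('C(#|S|, 2).*2 = #|S| * #|S|.-1)%N.
  rewrite bin2; have := odd_double_half (#|S| * #|S|.-1).
  by rewrite oddM; case: #|S| => //= n; rewrite andNb.
by move: cG cU cT; rewrite -muln2; nia.
Qed.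

(* The triples with [a *+ 2 - b - c = g] are determined by [c], hence number
   [#|A|], which is odd; so swapping [b] and [c] has a fixed point, whence
   [(a, b) |-> a *+ 2 - b *+ 2] would also be bijective. *)
Lemma sat_21_lower : (1 < #|G|)%N -> (#|G| < sat_21 G ^ 2)%N.
Proof.
move=> gt1G; have [A satA <-] := sat_21_attained G.
pose f (ab : G * G) := ab.1 *+ 2 - ab.2.
have /saturating21P sA := satA.
have imf : f @: setX A A = [set: G].
  by apply/setP => x; rewrite inE; have [ab abA ->] := sA x; apply: imset_f.
rewrite ltn_neqAle expnS expn1 -cardsX -[X in (X <= _)%N]cardsT -imf leq_imset_card andbT.
apply/eqP => cA.
have injf : {in setX A A &, injective f} by apply/imset_injP; rewrite imf cardsT cA.
have diff2 g : exists2 ab, ab \in setX A A & (ab.1 - ab.2) *+ 2 = g.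
  pose T := [set abc in setX (setX A A) A | f abc.1 - abc.2 == g].
  have cT : #|T| = #|A|.
    have <- : snd @: T = A.
      apply/setP => c; apply/imsetP/idP => [[abc + ->]|cA'].
        by rewrite !inE => /andP[/andP[_ ->]].
      have [ab abA gE] := sA (g + c).
      by exists (ab, c); rewrite // !inE -in_setX -surjective_pairing abA cA' /f -gE addrK eqxx.
    rewrite card_in_imset // => -[[a b] c] [[a' b'] c']; rewrite !inE -!in_setX /=.
    move=> /andP[/setXP[abA _] /eqP gE] /andP[/setXP[abA' _] /eqP gE'] cc'.
    rewrite -cc' in gE' *; congr (_, _); apply: injf => //.
    by rewrite -[LHS](subrK c) gE -gE' subrK.
  have oddA : odd #|A| by have := oddG; rewrite cA cardsX oddM andbb.
  rewrite -cT in oddA.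
  pose sw (abc : G * G * G) := (abc.1.1, abc.2, abc.1.2).
  have [||abc] := involution_odd_fixed (f := sw) _ _ oddA.
  - by case=> [[]].
  - case=> [[a b] c]; rewrite !inE /= => /andP[/andP[/andP[-> ->] ->] /eqP<-].
    by rewrite /f /= addrAC eqxx.
  case: abc => [[a b] c]; rewrite !inE /= => /andP[/andP[/andP[aA bA] cA'] /eqP gE] [cb _].
  by exists (a, b); rewrite ?inE ?aA //= -gE cb /f /= mulrnBl (mulr2n b) opprD addrA.
have imd : (fun ab => (ab.1 - ab.2) *+ 2) @: setX A A = [set: G].
  by apply/setP => g; rewrite inE; have [ab abA <-] := diff2 g; apply/imsetP; exists ab.
have /eqP/imset_injP injd : #|(fun ab => (ab.1 - ab.2) *+ 2) @: setX A A| = #|setX A A|.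
  by rewrite imd cardsT cA.
(* All diagonal pairs (a, a) have difference 0, so injectivity would leave only one element in
   [A]. *)
have /card_gt1P[a [b [aA bA]]] : (1 < #|A|)%N by move: cA gt1G; rewrite cardsX; nia.
case/eqP; have : (a, a) = (b, b) by apply: injd; rewrite ?inE ?aA ?bA //= !subrr.
by case.
Qed.
End OddOrder.

(** * Small (2,-1)-saturating sets in Z_p *)

Section PrimeField.
Variable p : nat.
Hypothesis p_pr : prime p.

(** Lifts the problem to the integers: the values 2a - b only have to fill the window [-L, p - L),
    which meets every residue class. The shift by [L] avoids negative numbers. *)
Lemma sat_21_Fp_le (s : seq nat) (L : nat) :
    (forall x, (x < p)%N -> exists a b, [/\ a \in s, b \in s & (x + b = a.*2 + L)%N]) ->
  (sat_21 'F_p <= size s)%N.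
Proof.
move=> cover; pose A : {set 'F_p} := [set:: [seq a%:R | a <- s]].
apply: (@leq_trans #|A|); last by rewrite cardsE (leq_trans (card_size _)) // size_map.
apply/sat_21_min/saturating21P => y.
pose z : 'F_p := y + L%:R.
have ltp : (val z < p)%N by have := ltn_ord z; rewrite [X in (_ < X)%N]Fp_cast.
have [a [b [sa sb E]]] := cover _ ltp.
exists (a%:R, b%:R); first by rewrite in_setX !inE; apply/andP; split; apply: map_f.
apply: (addIr L%:R); rewrite -/z -[z]natr_Zp /=; apply: (addIr b%:R).
by rewrite addrAC subrK mulr2n -!natrD E addnn.
Qed.

(** For I = [0, s), 2I - I is the interval [-(s - 1), 2(s - 1)] of 3s - 2 integers. *)
Lemma sat_21_Fp_interval (s : nat) : (0 < s)%N -> (p <= 3 * s - 2)%N -> (sat_21 'F_p <= s)%N.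
Proof.
move=> s_gt0 le_p; rewrite -[s in (_ <= s)%N](size_iota 0); apply: (@sat_21_Fp_le _ s.-1) => x ltx.
have [lex | gtx] := leqP x s.-1.
  by exists 0%N, (s.-1 - x)%N; rewrite !mem_iota; split; lia.
exists (uphalf (x - s.-1)), (odd (x - s.-1) : nat); have := odd_double_half (x - s.-1).
by rewrite uphalf_half !mem_iota; case: odd; split; lia.
Qed.

(* With I = [0, 2d) and J = {kd - 1 : 3 <= k < n + 3}, the integers of
   [-(n+1)d + 1, -2d], [-2d + 1, 4d - 2] and [4d - 1, 2dn + 4d - 2] lie in 2I - J,
   2I - I and 2J - I. For 2I - J this uses that consecutive multiples of the odd
   number d have different parities. *)
Lemma sat_21_Fp_two_progressions (d n : nat) :
    odd d -> (0 < n)%N -> (p <= 3 * d * n + 5 * d - 2)%N ->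
  (sat_21 'F_p <= 2 * d + n)%N.
Proof.
move=> odd_d n_gt0 le_p.
have d_gt0 : (0 < d)%N by case: d odd_d {le_p}.
pose s := iota 0 (2 * d) ++ [seq (3 * d - 1 + j * d)%N | j <- iota 0 n].
have <- : size s = (2 * d + n)%N by rewrite size_cat size_map !size_iota.
have sI a : (a < 2 * d)%N -> a \in s by move=> lta; rewrite mem_cat mem_iota lta.
have sJ k : (2 < k < n + 3)%N -> (k * d - 1)%N \in s.
  move=> hk; rewrite mem_cat; apply/orP; right; apply/mapP; exists (k - 3)%N.
    by rewrite mem_iota; lia.
  by nia.
(* -L is the lower end of the first range; the three ranges together have 3dn + 5d - 2 integers. *)
apply: (@sat_21_Fp_le _ (n.+1 * d - 1)) => x ltx; set L := (n.+1 * d - 1)%N.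
have [lex | gtx] := leqP (x + 2 * d) L.
  (* The target is -y = 2a - (kd - 1), so kd - 1 - y must be even and nonnegative. With q the
     quotient of y by d, one of k = q + 1, q + 2 has the right parity, and it keeps [a] below 2d. *)
  set y := (L - x)%N; have [q [r [yE ltr]]] : exists q r, y = (q * d + r)%N /\ (r < d)%N.
    by exists (y %/ d)%N, (y %% d)%N; rewrite -divn_eq ltn_mod.
  have [k [hk odd_k]] : exists k, (q < k <= q + 2)%N /\ odd (k * d) = ~~ odd y.
    have [E | E] := boolP (odd q.+1 == ~~ odd y); [exists q.+1 | exists q.+2];
      rewrite oddM odd_d andbT; split; try lia;
      by move: E => /=; case: (odd q); case: (odd y).
  have le1 : (2 <= q)%N by rewrite /y in yE; nia.
  have le2 : (q <= n)%N by rewrite /y /L in yE; nia.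
  have le3 : (y < k * d <= y + 2 * d)%N.
    have le_qk : (q.+1 * d <= k * d <= (q + 2) * d)%N by rewrite !leq_mul2r; lia.
    by move: le_qk; rewrite yE; lia.
  exists ((k * d - 1 - y)./2), (k * d - 1)%N.
  have even_k : odd (k * d - 1 - y) = false.
    have kdE : (k * d = k * d - 1 - y + y.+1)%N by lia.
    by move: odd_k; rewrite {1}kdE oddD /=; case: (odd y); case: (odd _).
  have := odd_double_half (k * d - 1 - y); rewrite even_k => half_k.
  split; [apply: sI; lia | apply: sJ; lia | rewrite /y in half_k le3; lia].
have [lex | gtx'] := leqP x (L + 4 * d - 2).
  have [leL | gtL] := leqP x L.
    by exists 0%N, (L - x)%N; split; [apply: sI; lia | apply: sI; lia | lia].
  exists (uphalf (x - L)), (odd (x - L) : nat); have := odd_double_half (x - L).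
  by rewrite uphalf_half; case: odd => h; split; try apply: sI; lia.
(* 2J has step 2d, the length of I, so 2J - I has no gaps. It starts at 2(3d - 1) - (2d - 1) = 4d -
   1, and [y] is the offset from there. *)
set y := (x - L - (4 * d - 1))%N.
have [q [r [yE ltr]]] : exists q r, y = (q * (2 * d) + r)%N /\ (r < 2 * d)%N.
  by exists (y %/ (2 * d))%N, (y %% (2 * d))%N; rewrite -divn_eq ltn_mod; split; lia.
have q2d : (q * (2 * d) = 2 * (q * d))%N by rewrite mulnCA.
have LE : L = (n * d + d - 1)%N by rewrite /L mulSn addnC.
have le_q : (q < n)%N.
  have [//|le_nq] := ltnP q n; have := leq_mul le_nq (leqnn d).
  by rewrite /y in yE; rewrite -mulnA [(d * n)%N]mulnC in le_p; lia.
exists ((q + 3) * d - 1)%N, (2 * d - 1 - r)%N; split; [apply: sJ; lia | apply: sI; lia |].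
by rewrite mulnDl; rewrite /y in yE; lia.
Qed.

Lemma between_squares (N : nat) : (0 < N)%N -> exists s, (s ^ 2 < N <= s.+1 ^ 2)%N.
Proof.
elim: N => // -[_ _|N /(_ isT)[s /andP[lt_s le_s]] _]; first by exists 0%N.
have [lt_N | ge_N] := ltnP N.+1 (s.+1 ^ 2); first by exists s; rewrite lt_N (ltn_trans lt_s).
by exists s.+1; rewrite !expnS expn0 in le_s ge_N *; lia.
Qed.

(** For the largest s with s^2 < 3p, s elements are enough: an interval when s < 8, two progressions
    otherwise. *)
Lemma sat_21_Fp_lt : (3 < p)%N -> (sat_21 'F_p ^ 2 < 3 * p)%N.
Proof.
move=> p_gt3; have [s /andP[lt_s le_s]] := @between_squares (3 * p) ltac:(lia).
suff le_sat : (sat_21 'F_p <= s)%N by apply: leq_ltn_trans lt_s; rewrite leq_exp2r.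
have [a [b [sE ltb]]] : exists a b, s = (8 * a + b)%N /\ (b < 8)%N.
  by exists (s %/ 8)%N, (s %% 8)%N; rewrite ltn_mod mulnC -divn_eq.
have odd_p : odd p by case: (even_prime p_pr) p_gt3 => [->|].
have p_mod3 : ~~ (3 %| p)%N by rewrite dvdn_prime2 // neq_ltn p_gt3.
rewrite !expnS expn0 in lt_s le_s.
have [a0 | a_gt0] := posnP a.
  have ltb8 : (3 <= s < 8)%N by nia.
  apply: sat_21_Fp_interval; first by lia.
  (* The interval bound covers p <= 19 when s = 7; 20 and 21 are not prime. *)
  have /orP[/eqP s7|lts7] : (s == 7)%N || (s < 7)%N by lia.
    by subst s; lia.
  by nia.
(* Under 2d + n = s, the product 3dn is largest at d = s/4, n = s/2, with value 3s^2/8, which leaves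
   room above the required s^2/3. Here d = 2a + 1 is an odd number close to s/4. *)
have -> : s = (2 * (2 * a + 1) + (4 * a + b - 2))%N by lia.
apply: sat_21_Fp_two_progressions; [lia | lia |].
have -> : (3 * (2 * a + 1) * (4 * a + b - 2) + 5 * (2 * a + 1) - 2 =
           24 * (a * a) + 6 * (a * b) + 10 * a + 3 * b - 3)%N by nia.
by rewrite sE in le_s; nia.
Qed.

End PrimeField.

(** * Orbits of v |-> -2v and sets spread along them *)

Lemma card_nondvd_succ (m o : nat) : (0 < m)%N ->
  (m * \sum_(i < o) ~~ (m %| i.+1) = (m - 1) * o + o %% m)%N.
Proof.
(* The sum is o minus the quotient of o by m; multiplied by m, this produces the remainder that
   becomes r3 or r2. *)
move=> m_gt0; have : (\sum_(i < o) ~~ (m %| i.+1) + o %/ m = o)%N.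
  elim: o => [|o IHo]; first by rewrite big_ord0 div0n.
  rewrite big_ord_recr /= divnS // [in X in (_ + X)%N]addnC addnACA IHo.
  by case: (m %| _)%N; rewrite /= ?addn0 ?add0n addn1.
have := divn_eq o m; move: (o %/ m)%N (o %% m)%N (\sum_(i < o) _)%N => q r t oE tE.
by rewrite -tE mulnDr mulnBl mul1n; nia.
Qed.

Definition neg2 (V : zmodType) (v : V) : V := - (v *+ 2).

Section Orbits.
Variables (p : nat) (p_pr : prime p) (p_gt3 : (3 < p)%N).
Local Notation o := (order_neg2 p_pr p_gt3).

Lemma natr_Fp_eq0 n : ((n%:R : 'F_p) == 0) = (p %| n)%N.
Proof. by rewrite -(dvdn_pcharf (pchar_Fp p_pr)). Qed.

Lemma mulrn_row_neq0 n (v : 'rV['F_p]_n) k : (0 < k < p)%N -> v != 0 -> v *+ k != 0.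
Proof.
move=> /andP[k_gt0 ltkp] v0; rewrite -scaler_nat scaler_eq0 negb_or v0 andbT.
by rewrite natr_Fp_eq0 gtnNdvd.
Qed.

Lemma neg2_neq0 n (v : 'rV['F_p]_n) : v != 0 -> neg2 v != 0.
Proof. by rewrite oppr_eq0 => /mulrn_row_neq0->; lia. Qed.

Lemma neg2_inj n : injective (@neg2 'rV['F_p]_n).
Proof.
move=> v w /eqP; rewrite -subr_eq0 => E; apply/eqP; rewrite -subr_eq0.
apply: contraTT E => /neg2_neq0; congr (_ != 0).
by rewrite /neg2 mulrnBl opprB opprK addrC.
Qed.

Lemma neg2_expr_eq i j :
  ((- 2%:R : 'F_p) ^+ i == (- 2%:R) ^+ j) = (i == j %[mod o])%N.
Proof.
rewrite /order_neg2 -eq_expg_mod_order; set u := FinRing.unit _ _.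
have uE k : (- 2%:R) ^+ k = val (u ^+ k)%g by rewrite FinRing.val_unitX.
by rewrite !uE (inj_eq val_inj).
Qed.

(** Both -2 = 1 and 4 = 1 in F_p would mean p | 3. Hence every orbit is long enough for gaps of
    3. *)
Lemma order_neg2_gt2 : (2 < o)%N.
Proof.
have := order_gt0 (FinRing.unit 'F_p (Fp_neg2_unit p_pr p_gt3)).
rewrite -/(order_neg2 p_pr p_gt3); case E : o => [|[|[|?]]] // _.
  have := neg2_expr_eq 1 0; rewrite E !modn1 eqxx expr1 expr0 -subr_eq0 -opprD oppr_eq0.
  by rewrite natr1 natr_Fp_eq0 gtnNdvd.
have := neg2_expr_eq 2 0; rewrite E modnn mod0n eqxx expr0 sqrrN -natrX -subr_eq0.
rewrite -[1]/(1%:R) -natrB // natr_Fp_eq0; apply: contraTeq => _.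
by rewrite gtnNdvd.
Qed.

(** The index counts steps from a root chosen on each orbit. It is well behaved modulo o because two
    powers of -2 agree on a nonzero vector only if their exponents agree modulo o. *)
Lemma neg2_index n : exists idx : 'rV['F_p]_n -> nat,
  forall v, v != 0 -> (idx v < o)%N /\ idx (neg2 v) = ((idx v).+1 %% o)%N.
Proof.
have o_gt0 : (0 < o)%N by apply: ltn_trans order_neg2_gt2.
have fE k v : iter k (@neg2 'rV['F_p]_n) v = (- 2%:R) ^+ k *: v.
  elim: k => [|k IHk]; first by rewrite expr0 scale1r.
  by rewrite iterS IHk /neg2 exprS -scalerA scaleNr scaler_nat.
have symf := fconnect_sym (@neg2_inj n).
exists (fun v => findex (@neg2 _) (froot (@neg2 _) v) v %% o)%N => v v_neq0.
rewrite ltn_mod o_gt0; split=> //.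
have conn w : fconnect (@neg2 'rV['F_p]_n) (froot (@neg2 _) w) w by rewrite symf connect_root.
have rf : froot (@neg2 _) (neg2 v) = froot (@neg2 _) v.
  by apply/esym/(fingraph.rootP symf); apply: fconnect1.
set r := froot (@neg2 _) v in rf *.
have E1 := iter_findex (conn v); have := iter_findex (conn (neg2 v)).
rewrite rf -/r -[in RHS]E1 -iterS.
rewrite !fE => /eqP; rewrite -subr_eq0 -scalerBl scaler_eq0 => /orP[|/eqP r0].
  by rewrite subr_eq0 neg2_expr_eq -/(neg2 v) => /eqP->; rewrite -[in RHS]addn1 modnDml addn1.
by case/eqP: v_neq0; rewrite -E1 fE -/r r0 scaler0.
Qed.

Lemma card_Fp_row n : #|'rV['F_p]_n| = (p ^ n)%N.
Proof. by rewrite card_mx card_Fp // mul1n. Qed.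

(** On each orbit, the points left out of [X] are at least [m] steps apart. *)
Definition spread n m (X : {set 'rV['F_p]_n}) :=
  forall v, v != 0 -> v \notin X -> forall l, (0 < l < m)%N -> iter l (@neg2 _) v \in X.

(** [neg2] maps each index class injectively into the next, cyclically, so the o classes have equal
    size (p^n - 1)/o. The set is a union of such classes, and its size is stated free of
    division. *)
Lemma spread_set n m : (0 < m <= o)%N -> exists X : {set 'rV['F_p]_n},
  [/\ 0 \notin X,
      (m * #|X| * o = (p ^ n - 1) * ((m - 1) * o + o %% m))%N &
      spread m X].
Proof.
case/andP=> m_gt0 le_mo; have [idx idxP] := neg2_index n.
have o_gt0 : (0 < o)%N by apply: leq_trans le_mo.
pose N i := #|[set v | (v != 0) && (idx v == i)]|.
have leN i j : (i <= j < o)%N -> (N i <= N j)%N.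
  elim: j => [|j IHj]; first by rewrite leqn0 => /andP[/eqP->].
  rewrite leq_eqVlt => /andP[/orP[/eqP->//|ltij] ltj].
  apply: leq_trans (IHj _) _; first by rewrite -ltnS ltij ltnW.
  rewrite /N -(card_imset _ (@neg2_inj n)); apply/subset_leq_card/subsetP => _ /imsetP[v + ->].
  rewrite !inE => /andP[v0 /eqP vj]; rewrite neg2_neq0 //=.
  by have [_ ->] := idxP v v0; rewrite vj modn_small.
have NE i : (i < o)%N -> N i = N 0.
  move=> lti; apply/eqP; rewrite eqn_leq (leN 0%N) // andbT.
  apply: (@leq_trans (N o.-1)); first by apply: leN; lia.
  rewrite /N -(card_imset _ (@neg2_inj n)); apply/subset_leq_card/subsetP => _ /imsetP[v + ->].
  rewrite !inE => /andP[v0 /eqP vj]; rewrite neg2_neq0 //=.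
  by have [_ ->] := idxP v v0; rewrite vj prednK // modnn.
have ordE v (i : 'I_o) : v != 0 -> (Ordinal (ltn_pmod (idx v) o_gt0) == i) = (idx v == i).
  by move=> /idxP[lti _]; rewrite -(inj_eq val_inj) /= modn_small.
have cardQ (Q : pred nat) : #|[set v | (v != 0) && Q (idx v)]| = (N 0 * \sum_(i < o) Q i)%N.
  rewrite -sum1_card (partition_big (fun v => Ordinal (ltn_pmod (idx v) o_gt0)) predT) //=.
  rewrite big_distrr /=; apply: eq_bigr => i _; rewrite -(NE i (ltn_ord i)) sum1dep_card /N.
  have [Qi | nQi] := boolP (Q i).
    rewrite muln1; apply: eq_card => v; rewrite !inE.
    have [->|v0] := eqVneq v 0; first by rewrite ?eqxx.
    by rewrite /= ordE //; case: eqP => [->|]; rewrite ?Qi ?andbF.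
  rewrite muln0; apply/eqP; rewrite cards_eq0; apply/eqP/setP => v; rewrite !inE.
  have [->|v0] := eqVneq v 0; first by rewrite ?eqxx.
  by rewrite /= ordE //; case: eqP => [->|]; rewrite ?andbF ?(negPf nQi).
(* Dropping the indices m - 1 mod m, rather than 0 mod m, keeps the gaps at least
   m where the orbit wraps around: the indices 0, .., m - 2 are all kept. *)
exists [set v | (v != 0) && ~~ (m %| (idx v).+1)%N]; split.
- by rewrite !inE eqxx.
- have := cardQ predT; rewrite sum1_card card_ord => cT.
  have : (p ^ n = (N 0 * o).+1)%N.
    rewrite -cT -card_Fp_row -cardsT (cardsD1 0 [set: _]) in_setT add1n; congr _.+1.
    by apply: eq_card => v; rewrite !inE andbT.
  rewrite (cardQ (fun i => ~~ (m %| i.+1)%N)) => ->.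
  by rewrite subn1 /= mulnCA -(card_nondvd_succ _ m_gt0) [RHS]mulnAC.
move=> v v0; rewrite inE v0 negbK => dvd_m l /andP[l_gt0 ltlm].
have [f0 idxE] : iter l (@neg2 _) v != 0 /\ idx (iter l (@neg2 _) v) = ((idx v + l) %% o)%N.
  elim: l {l_gt0 ltlm} => [|l [IH0 IHl]].
    by rewrite addn0 modn_small //; have [] := idxP v v0.
  rewrite iterS neg2_neq0 //; have [_ ->] := idxP _ IH0.
  by rewrite IHl -[in LHS]addn1 modnDml addn1 addnS.
rewrite inE f0 idxE; have [lti _] := idxP v v0.
have [lt_o | ge_o] := ltnP (idx v + l) o.
  by rewrite modn_small // -addSn dvdn_addr // gtnNdvd.
rewrite -(subnK ge_o) modnDr modn_small; last by lia.
by rewrite gtnNdvd //; lia.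
Qed.

(** * Upper bounds: saturating sets on the axes of F_p^a x F_p^b, and products *)

Ltac row_ring := apply/rowP => ?; rewrite !(mulr2n, mxE); ring.

Lemma row_halve n (v : 'rV['F_p]_n) : exists h, v = h *+ 2.
Proof.
exists (2%:R^-1 *: v); rewrite -scaler_nat scalerA divff ?scale1r //.
by rewrite natr_Fp_eq0 gtnNdvd // ltnW.
Qed.

Lemma odd_card_Fp_row n : odd #|'rV['F_p]_n|.
Proof.
rewrite card_Fp_row oddX; apply/orP; right.
by case: (even_prime p_pr) p_gt3 => [->|].
Qed.

(* [v = -2h] gives [v = 2h - (-2)v], and one of [h, -2h] as well as one of
   [v, -2v] lies in [X]. *)
Lemma neg2_neighbours n (X : {set 'rV['F_p]_n}) v :
    (forall v, v != 0 -> v \notin X -> neg2 v \in X) -> v != 0 -> v \notin X ->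
  exists h, [/\ h \in X, neg2 v \in X, h != neg2 v & v = h *+ 2 - neg2 v].
Proof.
move=> spreadX v0 vX; have [h hE] := row_halve (- v).
have vE : v = neg2 h by rewrite /neg2 -hE opprK.
have h0 : h != 0 by apply: contraNneq v0 => h0; rewrite vE h0 /neg2 mul0rn oppr0.
exists h; split; [|exact: spreadX| |].
- by apply: contraNT vX => hX; rewrite vE spreadX.
- rewrite vE -subr_eq0; apply: contraNneq (@mulrn_row_neq0 _ h 3 _ h0) => [E|]; last by lia.
  by rewrite -oppr_eq0 -E; apply/eqP; row_ring.
- by rewrite -hE /neg2 opprK mulr2n addKr.
Qed.

Lemma two_of_three n (X : {set 'rV['F_p]_n}) v : spread 3 X -> v != 0 ->
  [|| (v \in X) && (neg2 v \in X), (v \in X) && (neg2 (neg2 v) \in X)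
    | (neg2 v \in X) && (neg2 (neg2 v) \in X)].
Proof.
move=> sX v0; have := sX v v0; have := sX _ (neg2_neq0 v0).
case: (v \in X) => /= [H _|_ H]; last by rewrite (H isT 1%N) // (H isT 2%N).
by case: (neg2 v \in X) H => //= /(_ isT 1%N) ->.
Qed.

(** For v = 0 a pair x, -x in [X] is needed. Among e, -2e, 4e at most one is missing from [X], and
    likewise among their negatives, so one of the three opposite pairs is intact. *)
Lemma spread3_AP n (X : {set 'rV['F_p]_n}) : (0 < n)%N -> spread 3 X ->
  forall v, v \notin X -> exists a b, [/\ a \in X, b \in X, a != b &
     (v + v == a + b) || (v == a *+ 2 - b)].
Proof.
move=> n_gt0 spreadX v vX; have spread1 w : w != 0 -> w \notin X -> neg2 w \in X.
  by move=> w0 wX; apply: (spreadX w w0 wX 1).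
have [v0 | v0] := eqVneq v 0; last first.
  have [h [hX fX hv vE]] := neg2_neighbours spread1 v0 vX.
  by exists h, (neg2 v); split=> //; rewrite -vE eqxx orbT.
suff [x x0 /andP[xX nxX]] : exists2 x, x != 0 & (x \in X) && (- x \in X).
  exists x, (- x); split=> //; last by rewrite v0 addr0 subrr eqxx.
  by rewrite -subr_eq0 opprK -mulr2n mulrn_row_neq0 //; lia.
pose e : 'rV['F_p]_n := const_mx 1.
have e0 : e != 0.
  by apply/eqP => /rowP/(_ (Ordinal n_gt0)); rewrite !mxE => /eqP; rewrite oner_eq0.
have fN (w : 'rV['F_p]_n) : neg2 (- w) = - neg2 w by rewrite /neg2 mulNrn.
have := two_of_three spreadX e0; have := @two_of_three _ X (- e) spreadX.
rewrite oppr_eq0 (fN e) (fN (neg2 e)) => /(_ e0) H1 H2.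
have [E|] := boolP ((e \in X) && (- e \in X)); first by exists e.
have [E|] := boolP ((neg2 e \in X) && (- neg2 e \in X)).
  by exists (neg2 e); rewrite ?neg2_neq0.
have [E|] := boolP ((neg2 (neg2 e) \in X) && (- neg2 (neg2 e) \in X)).
  by exists (neg2 (neg2 e)); rewrite ?neg2_neq0.
by move: H1 H2; do 6!case: (_ \in X).
Qed.

Lemma sat_3AP_row_le a b : (0 < a)%N -> (0 < b)%N ->
  (3 * o * sat_3AP 'rV['F_p]_(a + b) <= (p ^ a + p ^ b - 2) * (2 * o + o %% 3))%N.
Proof.
move=> a_gt0 b_gt0; have o_ge3 : (0 < 3 <= o)%N := order_neg2_gt2.
have [X [X0 cX sX]] := spread_set a o_ge3; have [Y [Y0 cY sY]] := spread_set b o_ge3.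
pose S := [set row_mx x (0 : 'rV['F_p]_b) | x in X] :|:
          [set row_mx (0 : 'rV['F_p]_a) y | y in Y].
have SX x : x \in X -> row_mx x 0 \in S by move=> xX; apply/setUP; left; apply/imsetP; exists x.
have SY y : y \in Y -> row_mx 0 y \in S by move=> yY; apply/setUP; right; apply/imsetP; exists y.
have cS : (sat_3AP 'rV['F_p]_(a + b) <= #|X| + #|Y|)%N; last first.
  have pow_gt0 k : (0 < p ^ k)%N by rewrite expn_gt0 prime_gt0.
  have := pow_gt0 a; have := pow_gt0 b => pb pa.
  rewrite (leq_trans (leq_mul (leqnn (3 * o)) cS)) // mulnDr [(3 * o * #|X|)%N]mulnAC cX.
  rewrite [(3 * o * #|Y|)%N]mulnAC cY -mulnDl leq_mul2r; apply/orP; right; lia.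
suff satS : AP3_saturating S.
  apply: leq_trans (sat_3AP_min satS) _; rewrite cardsU.
  by apply: leq_trans (leq_subr _ _) _; rewrite leq_add // leq_imset_card.
have AP w x y : w \notin S -> x \in S -> y \in S -> x != y ->
    (w + w == x + y) || (w == x *+ 2 - y) -> [exists x in S, exists y in S, is_3AP [set w; x; y]].
  move=> wS xS yS xy H; apply/existsP; exists x; rewrite xS; apply/existsP; exists y; rewrite yS /=.
  apply: three_point_AP => //; last by rewrite orbA H.
    by apply: contraNneq wS => ->.
  by apply: contraNneq wS => ->.
apply/forallP => w; apply/implyP; rewrite -[w]hsubmxK.
move: (lsubmx w) (rsubmx w) => u v wS.
have [v0 | v0] := eqVneq v 0.
  have uX : u \notin X by apply: contra wS; rewrite v0; apply: SX.
  have [x [y [xX yX xy H]]] := spread3_AP a_gt0 sX uX.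
  apply: (AP _ _ _ wS (SX _ xX) (SX _ yX)).
    by apply: contraNneq xy => /eq_row_mx[-> _].
  case/orP: H => /eqP H; apply/orP; [left|right].
    by rewrite v0 !add_row_mx H !addr0.
  by rewrite v0 H !mulr2n opp_row_mx !add_row_mx oppr0 !addr0.
have [u0 | u0] := eqVneq u 0.
  have vY : v \notin Y by apply: contra wS; rewrite u0; apply: SY.
  have [x [y [xY yY xy H]]] := spread3_AP b_gt0 sY vY.
  apply: (AP _ _ _ wS (SY _ xY) (SY _ yY)).
    by apply: contraNneq xy => /eq_row_mx[_ ->].
  case/orP: H => /eqP H; apply/orP; [left|right].
    by rewrite u0 !add_row_mx H !addr0.
  by rewrite u0 H !mulr2n opp_row_mx !add_row_mx oppr0 !addr0.
have [x xE] := row_halve u; have [y yE] := row_halve v.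
have x0 : x != 0 by apply: contraNneq u0 => x0; rewrite xE x0 mul0rn.
have y0 : y != 0 by apply: contraNneq v0 => y0; rewrite yE y0 mul0rn.
have neq x' y' : x' \in X -> row_mx x' (0 : 'rV_b) != row_mx 0 y'.
  by move=> x'X; apply: contraNneq X0 => /eq_row_mx[<-].
(* The candidates (x, -2y), (-2x, y), (4x, 4y) share no coordinate position. [X] and [Y] each miss
   at most one position, which spoils at most two candidates. *)
have := two_of_three sX x0; have := two_of_three sY y0.
have [/andP[xX yY] _ _|] := boolP ((x \in X) && (neg2 y \in Y)).
  apply: (AP _ _ _ wS (SX _ xX) (SY _ yY)); first exact: neq.
  by rewrite xE yE /neg2 !mulr2n opp_row_mx !add_row_mx oppr0 !addr0 !add0r opprK eqxx orbT.
have [/andP[xX yY] _ _ _|] := boolP ((neg2 x \in X) && (y \in Y)).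
  apply: (AP _ _ _ wS (SY _ yY) (SX _ xX)); first by rewrite eq_sym neq.
  by rewrite xE yE /neg2 !mulr2n opp_row_mx !add_row_mx oppr0 !addr0 !add0r opprK eqxx orbT.
have [/andP[xX yY] _ _ _ _|] := boolP ((neg2 (neg2 x) \in X) && (neg2 (neg2 y) \in Y)).
  apply: (AP _ _ _ wS (SX _ xX) (SY _ yY)); first exact: neq.
  by rewrite xE yE !add_row_mx addr0 add0r /neg2 !mulNrn !opprK !mulr2n eqxx.
by do 3!case: (_ \in X); do 3!case: (_ \in Y).
Qed.

(** Only one of y, -2y is sure to lie in [Y], so the first axis must offer both x and -2x. It is
    therefore filled except for 0 and only the second axis is thinned out, whence 1 + 1/2 = 3/2. *)
Lemma sat_21_row_le a b : (0 < a)%N ->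
  (2 * o * sat_21 'rV['F_p]_(a + b) <= (p ^ a - 1) * (2 * o) + (p ^ b - 1) * (o + o %% 2))%N.
Proof.
move=> a_gt0; have o_ge2 : (0 < 2 <= o)%N := ltnW order_neg2_gt2.
have [Y [Y0 cY sY]] := spread_set b o_ge2.
have spreadY w : w != 0 -> w \notin Y -> neg2 w \in Y.
  by move=> w0 wY; apply: (sY w w0 wY 1%N).
pose S := [set row_mx x (0 : 'rV['F_p]_b) | x in [set~ 0]] :|:
          [set row_mx (0 : 'rV['F_p]_a) y | y in Y].
have SX x : x != 0 -> row_mx x 0 \in S.
  by move=> xX; apply/setUP; left; apply/imsetP; exists x; rewrite ?inE.
have SY y : y \in Y -> row_mx 0 y \in S by move=> yY; apply/setUP; right; apply/imsetP; exists y.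
have cS : (sat_21 'rV['F_p]_(a + b) <= (p ^ a - 1) + #|Y|)%N; last first.
  rewrite (leq_trans (leq_mul (leqnn (2 * o)) cS)) // mulnDr mulnC leq_add //.
  by rewrite mulnAC cY subn1 mul1n.
have cX : #|[set~ (0 : 'rV['F_p]_a)]| = (p ^ a - 1)%N.
  by rewrite cardsC1 card_Fp_row subn1.
suff satS : saturating21 S.
  apply: leq_trans (sat_21_min satS) _; rewrite cardsU -cX.
  by apply: leq_trans (leq_subr _ _) _; rewrite leq_add // leq_imset_card.
have sat2 w x y : x \in S -> y \in S -> w = x *+ 2 - y ->
    exists2 xy, xy \in setX S S & w = xy.1 *+ 2 - xy.2.
  by move=> xS yS wE; exists (x, y); rewrite ?in_setX ?xS.
apply/saturating21P => w; rewrite -[w]hsubmxK.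
move: (lsubmx w) (rsubmx w) => u v {w}.
have [u0 | u0] := eqVneq u 0.
  have [vY | vY] := boolP (v \in Y).
    by apply: (sat2 _ _ _ (SY _ vY) (SY _ vY)); rewrite u0 mulr2n addrK.
  have [v0 | v0] := eqVneq v 0.
    (* The origin is not in [S]; it is reached as 2(e, 0) - (2e, 0). *)
    pose e : 'rV['F_p]_a := const_mx 1.
    have e0 : e != 0.
      by apply/eqP => /rowP/(_ (Ordinal a_gt0)); rewrite !mxE => /eqP; rewrite oner_eq0.
    have e20 : e *+ 2 != 0 by rewrite mulrn_row_neq0 //; lia.
    apply: (sat2 _ _ _ (SX _ e0) (SX _ e20)).
    by rewrite u0 v0 !mulr2n opp_row_mx !add_row_mx oppr0 !addr0 subrr.
  have [h [hY fY _ {1}->]] := neg2_neighbours spreadY v0 vY.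
  apply: (sat2 _ _ _ (SY _ hY) (SY _ fY)).
  by rewrite u0 !mulr2n opp_row_mx !add_row_mx oppr0 !addr0.
have [v0 | v0] := eqVneq v 0.
  by apply: (sat2 _ _ _ (SX _ u0) (SX _ u0)); rewrite v0 mulr2n addrK.
have [x xE] := row_halve u; have [y yE] := row_halve v.
have x0 : x != 0 by apply: contraNneq u0 => x0; rewrite xE x0 mul0rn.
have y0 : y != 0 by apply: contraNneq v0 => y0; rewrite yE y0 mul0rn.
have [yY | yY] := boolP (y \in Y).
  have nu0 : - u != 0 by rewrite oppr_eq0.
  apply: (sat2 _ _ _ (SY _ yY) (SX _ nu0)).
  by rewrite yE !mulr2n opp_row_mx !add_row_mx oppr0 !addr0 !add0r opprK.
apply: (sat2 _ _ _ (SX _ x0) (SY _ (spreadY _ y0 yY))).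
by rewrite xE yE /neg2 !mulr2n opp_row_mx !add_row_mx oppr0 !addr0 !add0r opprK.
Qed.

(** The equation w = 2a - b is solved in each factor separately; [saturating21P] allows the pair in
    one factor to be repeated. *)
Lemma sat_21_row_add1 n :
  (sat_21 'rV['F_p]_(n + 1) <= sat_21 'rV['F_p]_n * sat_21 'F_p)%N.
Proof.
have [A /saturating21P sA <-] := sat_21_attained 'rV['F_p]_n.
have [C /saturating21P sC <-] := sat_21_attained 'F_p.
pose g (xc : 'rV['F_p]_n * 'F_p) : 'rV_(n + 1) := row_mx xc.1 (const_mx xc.2).
rewrite -cardsX; apply: leq_trans (leq_imset_card g _); apply/sat_21_min/saturating21P => w.
have [[a a'] /setXP[aA a'A] wl] := sA (lsubmx w).
have [[c c'] /setXP[cC c'C] wr] := sC (rsubmx w 0 0).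
exists (g (a, c), g (a', c')); first rewrite in_setX.
  by apply/andP; split; apply: imset_f; rewrite in_setX ?aA ?a'A.
rewrite -[LHS]hsubmxK wl /g /= !mulr2n opp_row_mx !add_row_mx; congr row_mx.
by apply/rowP => i; rewrite [i]ord1 wr !mxE mulr2n.
Qed.

End Orbits.

(** * Translation of the integer inequalities into real bounds *)

Lemma sqrt_lt_nat (R : rcfType) (c : R) (s N : nat) (x : R) :
  0 <= x -> x ^+ 2 = c * N%:R -> c * N%:R < s%:R ^+ 2 -> x < s%:R.
Proof. by move=> x_ge0 xE lt_s; rewrite -(@ltr_pXn2r _ 2) ?nnegrE ?ler0n // xE. Qed.

Lemma powR_half_sqr (R : realType) (P : R) (k : nat) : 0 <= P ->
  (P `^ (k%:R + 1 / 2)) ^+ 2 = P ^+ (2 * k + 1).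
Proof.
move=> P_ge0; rewrite -powR_mulrn ?powR_ge0 // -powRrM -powR_mulrn //.
by congr (_ `^ _); rewrite natrD natrM; field.
Qed.

Theorem theorem1p13 (R : realType) (p : nat) (p_pr : prime p) (p_gt3 : (3 < p)%N) :
  let P : R := p%:R in
  let o := order_neg2 p_pr p_gt3 in
  let r3 := (o %% 3)%N in
  let r2 := (o %% 2)%N in
  let s3AP n : R := (sat_3AP 'rV['F_p]_n)%:R in
  let s21 n : R := (sat_21 'rV['F_p]_n)%:R in
  exists c : R,
    [/\ 1 <= c <= 3,
        (sat_21 'F_p)%:R < Num.sqrt (c * P) &
        forall k : nat, (0 < k)%N ->
        [/\ Num.sqrt (2 / 3) * P ^+ k < s3AP (2 * k)%N
              <= (4 / 3 + 2 * r3%:R / (3 * o%:R)) * (P ^+ k - 1),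
            Num.sqrt (2 / 3) * P `^ (k%:R + 1 / 2) < s3AP (2 * k + 1)%N
              <= 2 / 3 * (P ^+ (k + 1) + P ^+ k - 2)
                 + r3%:R * (P ^+ (k + 1) + P ^+ k - 2) / (3 * o%:R),
            P ^+ k < s21 (2 * k)%N
              <= (3 / 2 + r2%:R / (2 * o%:R)) * (P ^+ k - 1) &
            P `^ (k%:R + 1 / 2) < s21 (2 * k + 1)%N
              <= Num.sqrt c * (3 / 2 + r2%:R / (2 * o%:R))
                 * (P ^+ k - 1) * Num.sqrt P]].
Proof.
move=> P o r3 r2 s3AP s21.
have o_gt0 : 0 < o%:R :> R by rewrite ltr0n (ltn_trans _ (order_neg2_gt2 p_pr p_gt3)).
have P_ge0 : 0 <= P by rewrite ler0n.
have pow_gt0 k : (0 < p ^ k)%N by rewrite expn_gt0 prime_gt0.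
have sat_p : (sat_21 'F_p)%:R < Num.sqrt (3 * P).
  rewrite -(@ltr_pXn2r _ 2) ?nnegrE ?ler0n ?sqrtr_ge0 // sqr_sqrtr ?mulr_ge0 //.
  by rewrite -natrX -natrM ltr_nat sat_21_Fp_lt.
exists 3; split=> [||k k_gt0]; [by lra | exact: sat_p |].
have low3 n : 2 / 3 * (p ^ n)%:R < s3AP n ^+ 2.
  have := sat_3AP_lower (odd_card_Fp_row p_pr p_gt3 n); rewrite (card_Fp_row p_pr).
  by rewrite -(ltr_nat R) !natrM natrX /s3AP; lra.
have low21 n : (0 < n)%N -> 1 * (p ^ n)%:R < s21 n ^+ 2.
  move=> n_gt0; have := sat_21_lower (odd_card_Fp_row p_pr p_gt3 n).
  rewrite (card_Fp_row p_pr) -{1}(exp1n n) ltn_exp2r // prime_gt1 // => /(_ isT).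
  by rewrite -(ltr_nat R) !natrX mul1r.
have upp3 a b : (0 < a)%N -> (0 < b)%N ->
    s3AP (a + b)%N <= (2 / 3 + r3%:R / (3 * o%:R)) * (P ^+ a + P ^+ b - 2).
  move=> a_gt0 b_gt0; have := sat_3AP_row_le p_pr p_gt3 a_gt0 b_gt0.
  have := pow_gt0 a; have := pow_gt0 b => pa pb.
  rewrite -(ler_nat R) !(natrM, natrD) natrB ?natrD ?natrX -/P -/o; last by lia.
  move=> H; rewrite -(ler_pM2l (_ : 0 < 3 * o%:R)) ?mulr_gt0 //.
  by apply: le_trans H _; rewrite le_eqVlt; apply/orP; left; apply/eqP; field; rewrite lt0r_neq0.
have upp21 : s21 (k + k)%N <= (3 / 2 + r2%:R / (2 * o%:R)) * (P ^+ k - 1).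
  have := sat_21_row_le p_pr p_gt3 k k_gt0.
  rewrite -(ler_nat R) !(natrM, natrD) natrB ?natrX -/P -/o //.
  move=> H; rewrite -(ler_pM2l (_ : 0 < 2 * o%:R)) ?mulr_gt0 //.
  by apply: le_trans H _; rewrite le_eqVlt; apply/orP; left; apply/eqP; field; rewrite lt0r_neq0.
have pow_sqr : (P ^+ k) ^+ 2 = (p ^ (2 * k))%:R by rewrite natrX -exprM mulnC.
have powR_sqr : (P `^ (k%:R + 1 / 2)) ^+ 2 = (p ^ (2 * k + 1))%:R.
  by rewrite natrX powR_half_sqr.
have sqrt23 : Num.sqrt (2 / 3) ^+ 2 = 2 / 3 :> R by rewrite sqr_sqrtr //; lra.
split; apply/andP; split.
- by apply: sqrt_lt_nat (low3 _); rewrite ?mulr_ge0 ?sqrtr_ge0 ?exprn_ge0 // exprMn sqrt23 pow_sqr.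
- have := upp3 _ _ k_gt0 k_gt0; rewrite addnn -mul2n => /le_trans; apply.
  by rewrite le_eqVlt; apply/orP; left; apply/eqP; field; rewrite lt0r_neq0.
- by apply: sqrt_lt_nat (low3 _); rewrite ?mulr_ge0 ?sqrtr_ge0 ?powR_ge0 // exprMn sqrt23 powR_sqr.
(* In odd dimension the axes have dimensions k + 1 and k. *)
- have -> : (2 * k + 1 = (k + 1) + k)%N by lia.
  have := upp3 (k + 1)%N k; rewrite addn1 => /(_ isT k_gt0)/le_trans; apply.
  by rewrite le_eqVlt; apply/orP; left; apply/eqP; field; rewrite lt0r_neq0.
- by apply: sqrt_lt_nat (low21 _ _); rewrite ?exprn_ge0 ?muln_gt0 // pow_sqr mul1r.
- by rewrite mul2n -addnn.
- by apply: sqrt_lt_nat (low21 _ _); rewrite ?powR_ge0 ?addn1 // powR_sqr mul1r addn1.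
(* The bound in dimension 2k is multiplied by that for the extra factor Z_p, which is below
   sqrt(3p). *)
rewrite mul2n -addnn; have := sat_21_row_add1 p (k + k).
rewrite -(ler_nat R) natrM => /le_trans; apply.
rewrite [leRHS](_ : _ = (3 / 2 + r2%:R / (2 * o%:R)) * (P ^+ k - 1) * Num.sqrt (3 * P)).
  by rewrite ler_pM // ltW.
by rewrite sqrtrM //; ring.
Qed.
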